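(* Let $p>3$ be a prime and $a\in R_p$ with $a\not\equiv 0\pmod p$. (i) If $p\equiv 2\pmod 3$, then $V_p(x^2+\frac ax)=\frac{2p-1}3$. (ii) If $p\equiv 1\pmod 3$, write $p=A^2+3B^2$ with $A,B\in\mathbb{Z}$ and $A\equiv 1\pmod 3$. Then $V_p(x^2+\frac ax)=\frac{2p-1+2A}3$ if $(2a^2)^{\frac{p-1}3}\equiv 1\pmod p$, and for $\varepsilon\in\{1,-1\}$, $V_p(x^2+\frac ax)=\frac{2p-1-A+3\varepsilon B}3$ if $(2a^2)^{\frac{p-1}3}\equiv \frac{-1+\varepsilon A/B}2\pmod p$.
   Context: $R_p$ denotes the set of rational numbers whose denominators are not divisible by $p$; congruences modulo $p$ are taken in $\mathbb{Z}/p\mathbb{Z}$. For a rational function $f$, $V_p(f(x))$ denotes the number of residues $b\in\{0,1,\ldots,p-1\}$ such that $f(x)\equiv b\pmod p$ is solvable with $x\in\{1,2,\ldots,p-1\}$. *)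

(* Defs.v *)
From mathcomp Require Import all_boot all_order all_algebra.
Set Implicit Arguments.
Unset Strict Implicit.
Unset Printing Implicit Defensive.
Import Order.TTheory GRing.Theory Num.Theory.
Local Open Scope ring_scope.

Definition Rp (p : nat) : {pred rat} := [pred r : rat | ~~ (p %| `|denq r|)%N].

(* [ratr] sends n/d to n%:~R / d%:~R; on [Rp p], for p prime, this is the
   reduction map to Z/pZ.  Off [Rp p] it is meaningless, since the inverse of
   0 in 'F_p is 0 by convention, hence the two membership tests. *)
Definition congp (p : nat) (u v : rat) : bool :=
  [&& u \in Rp p, v \in Rp p & ratr u == ratr v :> 'F_p].

(* A rational function is given by its values on rat.  A pole of f would be
   evaluated with the convention 0^-1 = 0, so f is meant to have no pole among
   1, ..., p - 1. *)
Definition V (p : nat) (f : rat -> rat) : nat :=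
  #|[set b : 'I_p | [exists x : 'I_p, (0 < x)%N && congp p (f x%:R) b%:R]]|.

(* Main.v *)
(* Work over a finite field F with q elements, with quadratic character chi, and let
   S(d) be the sum of chi(1 + d s^3) over s in F.  Distinct x, y have the same image
   under f(x) = x^2 + a / x exactly when x y (x + y) = a.  Give x the weight
   3 - #{y : x y (x + y) = a}: every nonempty fiber of f has total weight 3, and as
   that equation in y has discriminant x^4 + 4 a x, the number V of values of f
   satisfies 3 V = 2 q - 1 - S(4 a).
   If q = 2 mod 3, cubing is a bijection and S vanishes.  If q = 3 n + 1, S depends
   on d modulo cubes only; first and second moments give S_0 + S_1 + S_2 = 0 and
   S_0^2 + S_1^2 + S_2^2 = 6 q for the three classes, which with S(1) even and
   S(1) = 1 mod 3 forces, for q = p = A^2 + 3 B^2, that S(1) = -2 A and that the other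
   two values are A + 3 B and A - 3 B.  Finally S(d) = d^n S(1) in F, which tells
   these values apart. *)
Require Import Defs.
From mathcomp Require Import all_boot all_order all_algebra all_solvable all_field.
From mathcomp Require Import zify ring.
Set Implicit Arguments.
Unset Strict Implicit.
Unset Printing Implicit Defensive.
Import Order.TTheory GRing.Theory Num.Theory.
Local Open Scope ring_scope.

(** * Finite fields: primitive roots and power sums *)

Section FiniteField.
Variable F : finFieldType.

Lemma expf_card_pred (x : F) : x != 0 -> x ^+ #|F|.-1 = 1.
Proof.
move=> x0; apply: (mulfI x0); rewrite -exprS prednK ?expf_card ?mulr1 //.
by apply/card_gt0P; exists 0.
Qed.

Lemma card_neq0 : #|[pred x : F | x != 0]| = #|F|.-1.
Proof. by rewrite -(cardC1 (0 : F)); apply: eq_card. Qed.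

Lemma finField_prim_root : exists g : F, #|F|.-1.-primitive_root g.
Proof.
have q1 : (0 < #|F|.-1)%N by rewrite -subn1 subn_gt0 finNzRing_gt1.
pose rs := enum [pred x : F | x != 0].
have rsP : all #|F|.-1.-unity_root rs.
  apply/allP => x; rewrite mem_enum inE => x0.
  by apply/unity_rootP; exact: expf_card_pred.
have := has_prim_root q1 rsP (enum_uniq _).
by rewrite -cardE card_neq0 leqnn => /(_ isT)/hasP[g _ gP]; exists g.
Qed.

Lemma prim_root_neq0 (g : F) n : n.-primitive_root g -> g != 0.
Proof.
move=> gP; apply/eqP => g0; have := prim_expr_order gP.
rewrite g0 expr0n; case: n gP => [/prim_order_gt0|n _ /eqP] //=.
by rewrite eq_sym oner_eq0.
Qed.

Lemma prim_root_log (g x : F) :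
  #|F|.-1.-primitive_root g -> x != 0 -> exists i : 'I_(#|F|.-1), x = g ^+ i.
Proof.
move=> gP x0; have [i ->] := prim_rootP gP (expf_card_pred x0); by exists i.
Qed.

Lemma sum_prim_root (M : nmodType) (h : F -> M) (g : F) :
  #|F|.-1.-primitive_root g ->
  \sum_(x | x != 0) h x = \sum_(0 <= i < #|F|.-1) h (g ^+ i).
Proof.
move=> gP; have g0 := prim_root_neq0 gP.
rewrite big_mkord (reindex (fun i : 'I_(#|F|.-1) => g ^+ i)) /=.
  by apply: eq_bigl => i; rewrite expf_neq0.
pose inv x := odflt (Ordinal (prim_order_gt0 gP)) [pick i : 'I_(#|F|.-1) | x == g ^+ i].
exists inv => [i _ | x x0]; rewrite /inv; case: pickP => [j | no] /=.
- by rewrite (eq_prim_root_expr gP) !modn_small // => /eqP/val_inj.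
- by have := no i; rewrite eqxx.
- by move/eqP.
- by have [i xE] := prim_root_log gP x0; have := no i; rewrite xE eqxx.
Qed.

(** Substituting g x for x, with g a primitive root, multiplies the sum by g^k, which is not 1. *)
Lemma sum_expr_eq0 (k : nat) :
  ~~ (#|F|.-1 %| k)%N -> \sum_(x : F) x ^+ k = 0.
Proof.
move=> kN; have [g gP] := finField_prim_root.
have g0 := prim_root_neq0 gP.
have gk : g ^+ k != 1 by rewrite -(prim_order_dvd gP).
have gK : g ^+ k * \sum_(x : F) x ^+ k = \sum_(x : F) x ^+ k.
  rewrite big_distrr /= [RHS](reindex_inj (mulfI g0)).
  by apply: eq_bigr => x _; rewrite exprMn.
apply/eqP; have /eqP : (g ^+ k - 1) * \sum_(x : F) x ^+ k = 0.
  by rewrite mulrBl mul1r gK subrr.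
by rewrite mulf_eq0 subr_eq0 (negPf gk).
Qed.

End FiniteField.

(** * The quadratic character *)

Section QuadraticCharacter.
Variables (F : finFieldType) (m : nat).
Hypothesis cardF : #|F| = m.*2.+1.
Implicit Types x y d e : F.

Lemma odd_card_gt0 : (0 < m)%N.
Proof. by have := finNzRing_gt1 F; rewrite cardF; case: m. Qed.

(** If 2 = 0, then (g^m - 1)^2 = g^(2 m) + 1 = 0 for a primitive root g, although g has order 2
    m. *)
Lemma odd_card_two_neq0 : (2 : F) != 0.
Proof.
have [g gP] := finField_prim_root F; apply/eqP => F2.
have gm : g ^+ m != 1.
  rewrite -(prim_order_dvd gP) cardF /=; apply/negP => /dvdn_leq.
  by have := odd_card_gt0; lia.
have : (g ^+ m - 1) ^+ 2 == 0.
  rewrite sqrrB1 -exprM muln2 -[m.*2]/(m.*2.+1.-1) -cardF prim_expr_order //.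
  by rewrite -mulr_natr F2 mulr0 subr0 -[1 + 1]/2 F2.
by rewrite expf_eq0 /= subr_eq0 (negPf gm).
Qed.

(** Euler's criterion serves as the definition, m being (#|F| - 1) / 2; integer values keep the
    character sums out of F. *)
Definition chi x : int := if x == 0 then 0 else if x ^+ m == 1 then 1 else -1.

Lemma chi0 : chi 0 = 0.
Proof. by rewrite /chi eqxx. Qed.

Lemma chi1 : chi 1 = 1.
Proof. by rewrite /chi oner_eq0 expr1n eqxx. Qed.

Lemma expf_half x : x != 0 -> (x ^+ m == 1) || (x ^+ m == -1).
Proof.
move=> x0; rewrite -sqrf_eq1 -exprM muln2.
by rewrite -[m.*2]/(m.*2.+1.-1) -cardF expf_card_pred.
Qed.

Lemma chiE x : (chi x)%:~R = x ^+ m.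
Proof.
rewrite /chi; have [->|x0] := eqVneq x 0.
  by rewrite expr0n eqn0Ngt odd_card_gt0.
by case/orP: (expf_half x0) => /eqP->; rewrite ?eqxx //; case: eqP.
Qed.

Lemma odd_card_oneN_neq1 : (-1 : F) != 1.
Proof. by rewrite eq_sym -addr_eq0 odd_card_two_neq0. Qed.

Lemma chiM x y : chi (x * y) = chi x * chi y.
Proof.
rewrite /chi mulf_eq0; have [//|x0] := eqVneq x 0; first by rewrite mul0r.
have [//|y0] /= := eqVneq y 0; first by rewrite mulr0.
case/orP: (expf_half x0) => /eqP ex; case/orP: (expf_half y0) => /eqP ey.
all: by rewrite exprMn ex ey ?mulrNN ?mulr1 ?mul1r ?eqxx ?(negPf odd_card_oneN_neq1) ?eqxx.
Qed.

Lemma chi_sqr x : x != 0 -> chi (x ^+ 2) = 1.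
Proof.
move=> x0; rewrite /chi expf_eq0 (negPf x0) /= -exprM mulnC exprM.
by case/orP: (expf_half x0) => /eqP->; rewrite ?sqrrN expr1n eqxx.
Qed.

Lemma chi_neq0 x : x != 0 -> chi x = 1 \/ chi x = -1.
Proof. by move=> /negPf x0; rewrite /chi x0; case: ifP; [left | right]. Qed.

Lemma chi_cube x : chi (x ^+ 3) = chi x.
Proof.
have [->|x0] := eqVneq x 0; first by rewrite expr0n.
by rewrite exprS chiM chi_sqr // mulr1.
Qed.

(** For x = g^i, the equation x^m = 1 says that 2 m divides i m, so i is even. *)
Lemma chi_eq1_sqr x : chi x = 1 -> exists2 z, z != 0 & x = z ^+ 2.
Proof.
rewrite /chi; have [//|x0] := eqVneq x 0.
case: ifP => // /eqP xm _; have [g gP] := finField_prim_root F.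
have [i xE] := prim_root_log gP x0.
have : (m.*2 %| i * m)%N.
  by rewrite -[m.*2]/(m.*2.+1.-1) -cardF (prim_order_dvd gP) exprM -xE xm.
rewrite -mul2n dvdn_pmul2r ?odd_card_gt0 // dvdn2 => i_even.
exists (g ^+ i./2); first exact/expf_neq0/prim_root_neq0/gP.
by rewrite -exprM xE muln2 even_halfK.
Qed.

Lemma card_sqrt x : #|[set y | y ^+ 2 == x]|%:Z = 1 + chi x.
Proof.
have [->|x0] := eqVneq x 0.
  rewrite chi0 addr0; suff -> : [set y : F | y ^+ 2 == 0] = [set 0] by rewrite cards1.
  by apply/setP => y; rewrite !inE expf_eq0.
have [c1|c1] := chi_neq0 x0.
  have [z z0 xz] := chi_eq1_sqr c1.
  suff -> : [set y | y ^+ 2 == x] = [set z; - z].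
    rewrite c1 cards2 -addr_eq0 -mulr2n -mulr_natr mulf_eq0 (negPf z0).
    by rewrite (negPf odd_card_two_neq0).
  by apply/setP => y; rewrite !inE xz eqf_sqr.
rewrite c1 (_ : [set y | y ^+ 2 == x] = set0) ?cards0 //.
apply/setP => y; rewrite !inE; apply/eqP => yx.
have y0 : y != 0 by apply: contraNneq x0 => y0; rewrite -yx y0 expr0n.
by move: c1; rewrite -yx chi_sqr.
Qed.

(** Every y is a square root of exactly one x, so the numbers 1 + chi(x) of square roots add up to
    #|F|. *)
Lemma sum_chi : \sum_x chi x = 0.
Proof.
have : \sum_x (1 + chi x) = #|F|%:Z.
  under eq_bigr do rewrite -card_sqrt -sum1_card.
  rewrite -(big_morph Posz PoszD (erefl _)) -sum1_card.
  congr Posz; symmetry; rewrite (partition_big (fun y : F => y ^+ 2) predT) //=.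
  by apply: eq_bigr => x _; apply: eq_bigl => y; rewrite inE.
rewrite big_split /= sumr_const natz => /eqP.
by rewrite -subr_eq0 addrAC subrr add0r => /eqP.
Qed.

Lemma sum_chi_affine b c : b != 0 -> \sum_x chi (b * x + c) = 0.
Proof.
move=> b0; rewrite -[RHS]sum_chi [RHS](reindex_inj (addIr c)).
by rewrite [RHS](reindex_inj (mulfI b0)).
Qed.

Lemma sum_neq0 (M : zmodType) (h : F -> M) :
  \sum_(x | x != 0) h x = \sum_x h x - h 0.
Proof. by rewrite [\sum_x _](bigD1 0) //= addrC addrK. Qed.

(* With u = 1 + d, the product is u^2 times a value of the affine map
   v |-> (1 - e) v + e at v = 1 / u. *)
Lemma sum_chi_affine_mul e :
  \sum_d chi (1 + d) * chi (1 + d * e) = (e == 1)%:R * #|F|%:R - chi e.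
Proof.
rewrite (reindex_inj (addIr (-1))) /=.
transitivity (\sum_(u | u != 0) chi ((1 - e) * u^-1 + e)).
  rewrite (bigD1 0) //= [1 + _]addrC addrNK chi0 mul0r add0r.
  apply: eq_bigr => u u0; rewrite -chiM.
  rewrite -[RHS]mul1r -(chi_sqr u0) -chiM; congr chi.
  by field.
transitivity (\sum_(u | u != 0) chi ((1 - e) * u + e)).
  rewrite (reindex_inj (@invr_inj F)) /=; apply: eq_big => u; rewrite ?invr_eq0 //.
  by rewrite invrK.
rewrite sum_neq0 mulr0 add0r; congr (_ - _).
have [->|e1] := eqVneq e 1; last by rewrite mul0r sum_chi_affine // subr_eq0 eq_sym.
under eq_bigr do rewrite subrr mul0r add0r chi1.
by rewrite sumr_const mul1r.
Qed.

(** * Cubic character sums *)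

Definition cubic_sum d : int := \sum_s chi (1 + d * s ^+ 3).

Lemma cubic_sumMX d c : c != 0 -> cubic_sum (d * c ^+ 3) = cubic_sum d.
Proof.
move=> c0; rewrite /cubic_sum [RHS](reindex_inj (mulfI c0)) /=.
by apply: eq_bigr => s _; rewrite exprMn [in RHS]mulrA.
Qed.

Lemma cubic_sum0 : cubic_sum 0 = #|F|%:R.
Proof.
rewrite /cubic_sum; under eq_bigr do rewrite mul0r addr0 chi1.
by rewrite sumr_const.
Qed.

(** After exchanging the sums, each s != 0 sums chi over an affine bijection and gives 0; s = 0
    gives #|F|, which cancels the excluded term d = 0. *)
Lemma sum_cubic_sum : \sum_(d | d != 0) cubic_sum d = 0.
Proof.
rewrite sum_neq0 cubic_sum0 exchange_big /= (bigD1 0) //= [X in _ + X - _]big1 => [|s s0].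
  under eq_bigr do rewrite expr0n mulr0 addr0 chi1.
  by rewrite sumr_const addr0 subrr.
under eq_bigr do rewrite mulrC addrC.
by rewrite sum_chi_affine // expf_neq0.
Qed.

Lemma natr_card : #|F|%:R = 0 :> F.
Proof.
have : \sum_(x : F) x = \sum_(x : F) (x + 1) by rewrite (reindex_inj (addIr 1)).
rewrite big_split /= sumr_const => /eqP.
by rewrite -subr_eq0 opprD addrA subrr sub0r oppr_eq0 => /eqP.
Qed.

Lemma cubic_sum_eq0 k : #|F| = (3 * k).+2 -> forall d, d != 0 -> cubic_sum d = 0.
Proof.
move=> Fk d d0; rewrite -(sum_chi_affine 1 d0) /cubic_sum.
(* The exponent inverts 3 modulo #|F| - 1 = 3 k + 1, as 3 (2 k + 1) = 2 (3 k + 1) + 1. *)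
have cubeK : cancel (fun s : F => s ^+ 3) (fun s => s ^+ (2 * k + 1)).
  move=> s; rewrite -exprM; have [->|s0] := eqVneq s 0.
    by rewrite expr0n muln_eq0 addn1.
  rewrite (_ : 3 * _ = #|F|.-1 * 2 + 1)%N; last by rewrite Fk /=; lia.
  by rewrite exprD exprM expf_card_pred // expr1n mul1r.
rewrite [RHS](reindex_inj (can_inj cubeK)) /=.
by apply: eq_bigr => s _; rewrite addrC.
Qed.

(** * Cubic sums when #|F| is 1 modulo 3 *)

Section OneModThree.
Variable n : nat.
Hypothesis cardF3 : #|F| = (3 * n).+1.

Lemma card_third_gt0 : (0 < n)%N.
Proof. by have := finNzRing_gt1 F; rewrite cardF3; case: (n). Qed.

Lemma card_cube_root1 : #|[set r : F | r ^+ 3 == 1]| = 3.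
Proof.
have [g gP] := finField_prim_root F.
have wP : 3.-primitive_root (g ^+ n).
  have := exp_prim_root gP n; rewrite cardF3 /=.
  by rewrite gcdnMl mulnK ?card_third_gt0.
move: (g ^+ n) wP => w wP; have w3 := prim_expr_order wP.
have w1 : w != 1 by rewrite -[w]expr1 -(prim_order_dvd wP).
have w21 : w ^+ 2 != 1 by rewrite -(prim_order_dvd wP).
have w0 := prim_root_neq0 wP.
have wD : 1 + w + w ^+ 2 = 0.
  apply/eqP; have /eqP : (w - 1) * (1 + w + w ^+ 2) = 0.
    by transitivity (w ^+ 3 - 1); [ring | rewrite w3 subrr].
  by rewrite mulf_eq0 subr_eq0 (negPf w1).
rewrite (_ : [set _ | _] = [set 1; w; w ^+ 2]).
  rewrite -setUA !cardsU1 cards1 !inE negb_or ![1 == _]eq_sym w1 w21 /=.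
  suff -> : w != w ^+ 2 by [].
  by apply: contra w1 => /eqP ww; apply/eqP/(mulfI w0); rewrite mulr1 -expr2.
apply/setP => r; rewrite !inE -subr_eq0.
have -> : r ^+ 3 - 1 = (r - 1) * (r - w) * (r - w ^+ 2).
  (* The middle expression is the expanded product; its extra terms vanish by [wD] and [w3]. *)
  transitivity ((r ^+ 3 - 1) - (1 + w + w ^+ 2) * r ^+ 2
     + w * (1 + w + w ^+ 2) * r + (1 - w ^+ 3)).
    by rewrite wD w3; ring.
  by ring.
by rewrite !mulf_eq0 !subr_eq0.
Qed.

(** Expand one factor of the square over s. The part s = 0 vanishes by [sum_cubic_sum]; for s != 0,
    scaling d by the cube s^3 turns the part into [K]. Expanding [K] over r, [sum_chi_affine_mul]
    yields 3 #|F| from the three cube roots of 1, and the excluded d = 0 removes #|F|. *)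
Lemma sum_cubic_sum_sqr :
  \sum_(d | d != 0) cubic_sum d ^+ 2 = (#|F|.-1)%:R * (2 * #|F|%:R).
Proof.
pose K := \sum_(d | d != 0) chi (1 + d) * cubic_sum d.
have KE : K = 2 * #|F|%:R.
  rewrite /K sum_neq0 addr0 chi1 mul1r cubic_sum0.
  under eq_bigr do rewrite /cubic_sum mulr_sumr.
  rewrite exchange_big /=.
  under eq_bigr do rewrite sum_chi_affine_mul chi_cube.
  rewrite big_split /= sumrN sum_chi subr0 -mulr_suml.
  have -> : \sum_(r : F) (r ^+ 3 == 1)%:R = 3%:R :> int.
    rewrite -[3%N in RHS]card_cube_root1 -sum1_card natr_sum [RHS]big_mkcond /=.
    by apply: eq_bigr => r _; rewrite inE; case: eqP.
  by ring.
under eq_bigr do rewrite expr2 {1}/cubic_sum mulr_suml.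
rewrite exchange_big /= (bigD1 0) //=.
under eq_bigr do rewrite expr0n mulr0 addr0 chi1 mul1r.
rewrite sum_cubic_sum add0r -KE mulr_natl -card_neq0 -sumr_const.
apply: eq_bigr => s s0; have s30 : s ^+ 3 != 0 by rewrite expf_neq0.
rewrite /K [RHS](reindex_inj (mulIf s30)) /=; apply: eq_big => d.
  by rewrite mulf_eq0 negb_or s30 andbT.
by rewrite cubic_sumMX.
Qed.

Lemma sum_period (M : nmodType) (h : nat -> M) k l :
  (forall i, h (i + k)%N = h i) ->
  \sum_(0 <= i < l * k) h i = (\sum_(0 <= i < k) h i) *+ l.
Proof.
move=> hk; have hkl i j : h (i + j * k)%N = h i.
  by elim: j => [|j IH]; rewrite ?addn0 // mulSn addnCA addnC hk.
elim: l => [|l IH]; first by rewrite mul0n big_nil mulr0n.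
rewrite mulSn addnC (@big_cat_nat _ _ _ (l * k)) ?leq_addr //= IH mulrSr.
congr (_ + _); rewrite -{1}[(l * k)%N]add0n big_addn addKn.
by apply: eq_bigr.
Qed.

Lemma cubic_sum_prim_root_period g i :
  #|F|.-1.-primitive_root g -> cubic_sum (g ^+ (i + 3)) = cubic_sum (g ^+ i).
Proof. by move=> gP; rewrite exprD cubic_sumMX // (prim_root_neq0 gP). Qed.

(** Over d = g^i the summand has period 3 in i, so the total is n times the sum over the classes of
    1, g and g^2 modulo cubes. *)
Lemma sum_cubic_sum_classes g : #|F|.-1.-primitive_root g ->
  cubic_sum 1 + cubic_sum g + cubic_sum (g ^+ 2) = 0.
Proof.
move=> gP; have := sum_cubic_sum; rewrite (sum_prim_root _ gP) cardF3 /= mulnC.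
rewrite sum_period => [|i]; last exact: cubic_sum_prim_root_period.
rewrite !big_nat_recr //= big_nil add0r expr0 expr1 => /eqP.
by rewrite mulrn_eq0 eqn0Ngt card_third_gt0 => /eqP.
Qed.

Lemma sum_cubic_sum_sqr_classes g : #|F|.-1.-primitive_root g ->
  cubic_sum 1 ^+ 2 + cubic_sum g ^+ 2 + cubic_sum (g ^+ 2) ^+ 2 = 6 * #|F|%:R.
Proof.
move=> gP; have := sum_cubic_sum_sqr.
rewrite (sum_prim_root _ gP) [in LHS]cardF3 /= mulnC.
rewrite sum_period => [|i]; last by rewrite cubic_sum_prim_root_period.
rewrite !big_nat_recr //= big_nil add0r expr0 expr1 => nE.
have n0 : n%:R != 0 :> int by rewrite pnatr_eq0 -lt0n card_third_gt0.
apply: (mulIf n0); rewrite [LHS]mulr_natr nE.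
rewrite [in #|F|.-1]cardF3 /= natrM; ring.
Qed.

(** The term s = 0 is 1, and each nonzero cube is s^3 for three values of s: (g^i)^3 has period n in
    i < 3 n. *)
Lemma cubic_sum_mod3 d : exists k : int, cubic_sum d = 1 + 3 * k.
Proof.
have [g gP] := finField_prim_root F.
exists (\sum_(0 <= i < n) chi (1 + d * (g ^+ i) ^+ 3)).
rewrite /cubic_sum (bigD1 0) //= expr0n mulr0 addr0 chi1; congr (_ + _).
rewrite (sum_prim_root _ gP) {1}cardF3 /= sum_period ?mulr_natl // => i.
congr (chi (1 + d * _)); rewrite -!exprM mulnDl exprD [(n * 3)%N]mulnC.
by rewrite -[(3 * n)%N]/((3 * n).+1.-1) -cardF3 (prim_expr_order gP) mulr1.
Qed.

(** The summand chi + 1, increased by 1 where chi = 0, is 0 or 2. As 1 + s^3 has three roots,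
    [cubic_sum 1] + #|F| + 3 is even, and #|F| is odd. *)
Lemma cubic_sum1_even : exists k : int, cubic_sum 1 = 2 * k.
Proof.
pose N := #|[set s : F | 1 + s ^+ 3 == 0]|.
have NE : N = 3.
  rewrite -card_cube_root1 /N -[RHS](card_imset _ (@oppr_inj F)).
  congr #|pred_of_set _|; apply/setP => s.
  rewrite -[s in RHS]opprK (mem_imset _ _ (@oppr_inj F)).
  rewrite !inE; have -> : (- s) ^+ 3 = - (s ^+ 3) by ring.
  by rewrite addrC addr_eq0 eqr_oppLR.
have : \sum_(s : F) (chi (1 + s ^+ 3) + 1 + (1 + s ^+ 3 == 0)%:R)
     = 2 * \sum_(s : F) (chi (1 + s ^+ 3) != -1)%:R.
  rewrite mulr_sumr; apply: eq_bigr => s _.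
  have [->|x0] := eqVneq (1 + s ^+ 3) 0; first by rewrite chi0.
  by case: (chi_neq0 x0) => ->.
rewrite !big_split /= sumr_const cardF.
have -> : \sum_(s : F) (1 + s ^+ 3 == 0)%:R = 3%:R :> int.
  rewrite -[3%N in RHS]NE /N -sum1_card natr_sum [RHS]big_mkcond /=.
  by apply: eq_bigr => s _; rewrite inE; case: eqP.
have -> : \sum_(s : F) chi (1 + s ^+ 3) = cubic_sum 1.
  by apply: eq_bigr => s _; rewrite mul1r.
set T := \sum_s _ => E; exists (T - m%:R - 2).
move: E; rewrite -addnn mulrS natrD; lia.
Qed.

(* Only the monomial of degree n in d survives: by Euler's criterion the sum is
   a polynomial of degree at most m in d, and power sums over F vanish unless
   the exponent is a multiple of #|F| - 1 = 2 m = 3 n. *)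
Lemma cubic_sum_expr d : d != 0 -> (cubic_sum d)%:~R = d ^+ n * (cubic_sum 1)%:~R.
Proof.
move=> d0; have mn : m.*2 = (3 * n)%N by apply: succn_inj; rewrite -cardF cardF3.
suff E x : (cubic_sum x)%:~R = x ^+ n * (\sum_(s : F) s ^+ (3 * n)) *+ 'C(m, n).
  by rewrite !E expr1n mul1r mulrnAr.
have nm : (n < m.+1)%N by lia.
transitivity (\sum_(k < m.+1) (x ^+ k * (\sum_(s : F) s ^+ (3 * k))) *+ 'C(m, k)).
  rewrite /cubic_sum rmorph_sum /=.
  under eq_bigr do rewrite chiE exprDn.
  rewrite exchange_big /=; apply: eq_bigr => k _.
  rewrite mulr_sumr -sumrMnl; apply: eq_bigr => s _.
  by rewrite expr1n mul1r exprMn -exprM.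
rewrite (bigD1 (Ordinal nm)) //= [X in _ + X]big1 ?addr0 // => k kn.
have {}kn : nat_of_ord k != n by [].
(* The exponent 0 escapes [sum_expr_eq0], but there the power sum is #|F|, which is 0 in F. *)
have [k0|k0] := eqVneq (nat_of_ord k) 0%N.
  by rewrite k0 muln0 sumr_const natr_card mulr0 mul0rn.
rewrite sum_expr_eq0 ?mulr0 ?mul0rn // cardF3 /= dvdn_pmul2l //.
(* Divisibility makes k a multiple of n; 0 and n are excluded, and 2 n already exceeds m = 3 n /
   2. *)
apply/negP => /dvdnP[[|[|j]] jE]; have := ltn_ord k; nia.
Qed.

End OneModThree.
End QuadraticCharacter.

(** * Values of x^2 + a / x *)

Section Values.
Variables (F : finFieldType) (m : nat).
Hypothesis cardF : #|F| = m.*2.+1.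
Hypothesis three_neq0 : (3 : F) != 0.
Variable a : F.
Hypothesis a_neq0 : a != 0.
Implicit Types x y z b : F.

Let f x := x ^+ 2 + a / x.

(** What remains of f y = f x after division by y - x, without demanding y != x: x itself is an
    element when 2 x^3 = a. *)
Definition cofiber x : {set F} := [set y | x * y * (x + y) == a].

(** Complete the square: 4 x (x y (x + y) - a) = (2 x y + x^2)^2 - (x^4 + 4 a x). *)
Lemma card_cofiber x : x != 0 -> #|cofiber x|%:Z = 1 + chi m (x ^+ 4 + 4 * a * x).
Proof.
move=> x0; rewrite -(card_sqrt cardF).
have x20 : 2 * x != 0 by rewrite mulf_neq0 // (odd_card_two_neq0 cardF).
rewrite -[in RHS](card_preimset _ (inj_comp (addIr (x ^+ 2)) (mulfI x20))).
congr Posz; apply: eq_card => y; rewrite !inE -subr_eq0 -[RHS]subr_eq0.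
transitivity (4 * x * (x * y * (x + y) - a) == 0); last by congr (_ == _); rewrite /=; ring.
rewrite mulf_eq0 (_ : 4 * x = 2 * (2 * x)); last by ring.
by rewrite mulf_eq0 (negPf x20) (negPf (odd_card_two_neq0 cardF)).
Qed.

Lemma cofiber_neq0 x y : y \in cofiber x -> (x != 0) && (y != 0).
Proof.
rewrite inE => /eqP xya; apply/andP; split; apply: contra_neq a_neq0 => e.
  by rewrite -xya e !mul0r.
by rewrite -xya e mulr0 mul0r.
Qed.

Lemma value_eq x y : x != 0 -> y != 0 ->
  (f y == f x) = (y == x) || (y \in cofiber x).
Proof.
move=> x0 y0; rewrite inE -[LHS]subr_eq0 -[y == x]subr_eq0 -[_ == a]subr_eq0 -mulf_eq0.
have xy0 : x * y != 0 by rewrite mulf_neq0.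
transitivity ((y - x) * (x * y * (x + y) - a) / (x * y) == 0).
  by congr (_ == _); rewrite /f; field; rewrite x0 y0.
by rewrite [LHS]mulf_eq0 invr_eq0 (negPf xy0) orbF.
Qed.

(** Here x, y, z are the roots of some t^3 - b t + a, and x t (x + t) - a = x (t - y) (t - z). *)
Lemma cofiber_vieta x y z : x * y * z = - a -> x + y + z = 0 ->
  cofiber x = [set y; z].
Proof.
move=> xyz s; have zE : z = - x - y by rewrite -[RHS]addr0 -s; ring.
have x0 : x != 0 by apply: contra_eq_neq xyz => ->; rewrite !mul0r eq_sym oppr_eq0.
apply/setP => t; rewrite !inE -subr_eq0 -[t == y]subr_eq0 -[t == z]subr_eq0 -mulf_eq0.
rewrite (_ : x * t * (x + t) - a = x * ((t - y) * (t - z))).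
  by rewrite [LHS]mulf_eq0 (negPf x0).
by rewrite -[a]opprK -xyz zE; ring.
Qed.

(* [cofiber x] is the root set of (t^3 - b t + a) / (t - x); it contains x when x is a
   double root. *)
Lemma sum_fiber b : b \in [set f x | x in [set x | x != 0]] ->
  \sum_(x in [set x | x != 0] | f x == b) (3 - #|cofiber x|%:Z) = 3.
Proof.
case/imsetP=> x; rewrite inE => x0 ->.
have [T0|[y yT]] := set_0Vmem (cofiber x).
  rewrite (eq_bigl (pred1 x)) => [|t]; last first.
    rewrite !inE; have [->|t0] /= := eqVneq t 0; first by rewrite eq_sym (negPf x0).
    by rewrite value_eq // T0 inE orbF.
  by rewrite big_pred1_eq T0 cards0 subr0.
have /andP[_ y0] := cofiber_neq0 yT.
pose z := - x - y.
have s : x + y + z = 0 by rewrite /z; ring.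
have xyz : x * y * z = - a by move: yT; rewrite inE => /eqP <-; rewrite /z; ring.
have Tx : cofiber x = [set y; z] by exact: cofiber_vieta.
have Ty : cofiber y = [set x; z].
  by apply: cofiber_vieta; rewrite -?xyz -?s; ring.
have Tz : cofiber z = [set x; y].
  by apply: cofiber_vieta; rewrite -?xyz -?s; ring.
have xyzN : ~ (x = y /\ x = z).
  case=> xy xz; move: s; rewrite -xy -xz => /eqP.
  by rewrite (_ : x + x + x = 3 * x) ?mulf_eq0 ?(negPf x0) ?(negPf three_neq0) //; ring.
rewrite (eq_bigl (mem [set x; y; z])) => [|t]; last first.
  rewrite !inE -orbA; have [t0|t0] /= := eqVneq t 0.
    rewrite t0 ![0 == _]eq_sym (negPf x0) (negPf y0) /=; apply/esym/eqP => z0.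
    by move: xyz; rewrite z0 mulr0 => /eqP; rewrite eq_sym oppr_eq0 (negPf a_neq0).
  by rewrite value_eq // Tx !inE.
(* A double root has weight 3 - 2 = 1 and the simple root beside it weight 3 - 1 = 2; three distinct
   roots have weight 1 each. *)
have [xy|xy] := eqVneq x y.
  have yz : y != z by apply/eqP => yz; apply: xyzN; split; rewrite // -yz.
  rewrite xy setUid big_setU1 ?inE //= big_set1 -{1}xy Tx Tz -xy setUid.
  by rewrite xy cards2 yz cards1.
have [xz|xz] := eqVneq x z.
  rewrite -xz setUC setUA setUid big_setU1 ?inE //= big_set1 Tx Ty -xz setUid.
  by rewrite cards2 eq_sym xy cards1.
have [yz|yz] := eqVneq y z.
  rewrite -yz -setUA setUid big_setU1 ?inE //= big_set1 Tx Ty -yz setUid.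
  by rewrite cards2 xy cards1.
rewrite -setUA !big_setU1 ?inE ?negb_or ?xy ?xz ?yz //= big_set1 Tx Ty Tz.
by rewrite !cards2 xy xz yz.
Qed.

Lemma card_values :
  3 * #|[set f x | x in [set x | x != 0]]|%:Z
  = 2 * #|F|%:Z - 1 - cubic_sum m (4 * a).
Proof.
have -> : 3 * #|[set f x | x in [set x | x != 0]]|%:Z
        = \sum_(x in [set x : F | x != 0]) (3 - #|cofiber x|%:Z).
  rewrite (partition_big_imset f) /= (eq_bigr (fun=> 3)) => [|b]; last exact: sum_fiber.
  by rewrite sumr_const -[RHS]mulr_natr [#|_|%:R]natz.
transitivity (\sum_(x : F | x != 0) (2 - chi m (1 + 4 * a * x ^+ 3))).
  (* With s = 1 / x, the discriminant x^4 + 4 a x is (x^2)^2 (1 + 4 a s^3), and chi ignores the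
     square factor. *)
  rewrite [RHS](reindex_inj (@invr_inj F)) /=.
  rewrite (eq_bigl (fun x => x^-1 != 0)) => [|x]; last by rewrite inE invr_eq0.
  apply: eq_bigr => x; rewrite invr_eq0 => x0.
  rewrite card_cofiber // (_ : x ^+ 4 + _ = (x ^+ 2) ^+ 2 * (1 + 4 * a * x^-1 ^+ 3)).
    by rewrite (chiM cardF) (chi_sqr cardF) ?expf_neq0 // mul1r; ring.
  by field.
rewrite sumrB sumr_const card_neq0 sum_neq0 -/(cubic_sum m (4 * a)).
by rewrite expr0n mulr0 addr0 chi1 cardF /= -mulr_natr natz; lia.
Qed.
End Values.

(** * The form A^2 + 3 B^2 *)

Lemma dvd3_sqr (x k : int) : x ^+ 2 = 3 * k -> exists l, x = 3 * l.
Proof.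
move=> xk; exists (x %/ 3)%Z; have := divz_eq x 3; have := ltz_mod x (isT : (3 : int) != 0).
have := modz_ge0 x (isT : (3 : int) != 0).
move: (x %/ 3)%Z (x %% 3)%Z => l r r0 r3 xE.
have [r0'|[r1|r2]] : r = 0 \/ r = 1 \/ r = 2 by lia.
- by rewrite xE r0'; ring.
- by move: xk; rewrite xE r1; lia.
- by move: xk; rewrite xE r2; lia.
Qed.

(* Brahmagupta's identity gives p^2 = (A C + 3 B D)^2 + 3 (A D - B C)^2 and the
   same with the signs exchanged, while p divides (A D - B C)(A D + B C). *)
Lemma prime_form_unique (p : nat) (A B C D : int) : prime p ->
  p%:Z = A ^+ 2 + 3 * B ^+ 2 -> p%:Z = C ^+ 2 + 3 * D ^+ 2 ->
  A ^+ 2 = C ^+ 2 /\ B ^+ 2 = D ^+ 2.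
Proof.
move=> p_pr pAB pCD; have p0 := prime_gt0 p_pr.
have E : (A * D - B * C) * (A * D + B * C) = p%:Z * (D ^+ 2 - B ^+ 2).
  by rewrite [in RHS]mulrBr {1}pAB pCD; ring.
suff z : (A * D - B * C) * (A * D + B * C) = 0.
  have DB : D ^+ 2 = B ^+ 2 by move: E; rewrite z; nia.
  by split=> //; move: pAB pCD; rewrite DB; lia.
(* If v = k p with k != 0, then 3 v^2 >= 3 p^2 > p^2. *)
have dvd_eq0 u v : (p%:Z) ^+ 2 = u ^+ 2 + 3 * v ^+ 2 -> (p %| v)%Z -> v = 0.
  move=> uv /dvdzP[k vE]; have [k0|k0] := eqVneq k 0; first by rewrite vE k0 mul0r.
  have p2 : 0 < p%:Z ^+ 2 by rewrite exprn_gt0.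
  have k2 : 0 <= k ^+ 2 - 1 by rewrite subr_ge0 -gtz0_ge1 exprn_even_gt0.
  have := mulr_ge0 k2 (ltW p2); have := sqr_ge0 u; move: uv p2; rewrite vE.
  by clear; lia.
have : (p %| (A * D - B * C) * (A * D + B * C))%Z by rewrite E dvdz_mulr.
have id1 : (p%:Z) ^+ 2 = (A * C + 3 * B * D) ^+ 2 + 3 * (A * D - B * C) ^+ 2.
  by rewrite expr2 {1}pAB pCD; ring.
have id2 : (p%:Z) ^+ 2 = (A * C - 3 * B * D) ^+ 2 + 3 * (A * D + B * C) ^+ 2.
  by rewrite expr2 {1}pAB pCD; ring.
rewrite dvdzE abszM Euclid_dvdM // => /orP[] d.
- by rewrite (dvd_eq0 _ _ id1) ?mul0r // dvdzE.
- by rewrite (dvd_eq0 _ _ id2) ?mulr0 // dvdzE.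
Qed.

(** Eliminating S2 gives (S1 + k)^2 = 3 (p - k^2), so S1 + k = 3 D and p = k^2 + 3 D^2. Uniqueness
    of the form yields k = A or -A and D = B or -B; the residues modulo 3 leave k = -A. *)
Lemma cubic_sum_classes_eq (p : nat) (A B S0 S1 S2 k l j : int) : prime p ->
  p%:Z = A ^+ 2 + 3 * B ^+ 2 -> A = 1 + 3 * j ->
  S0 = 2 * k -> S0 = 1 + 3 * l ->
  S0 + S1 + S2 = 0 -> S0 ^+ 2 + S1 ^+ 2 + S2 ^+ 2 = 6 * p%:Z ->
  S0 = - 2 * A /\ (S1 = A + 3 * B /\ S2 = A - 3 * B \/ S1 = A - 3 * B /\ S2 = A + 3 * B).
Proof.
move=> p_pr pAB Aj S0k S0l sum0 sum2.
have S2E : S2 = - S0 - S1 by move: sum0; clear; lia.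
have sq : (S1 + k) ^+ 2 = 3 * (p%:Z - k ^+ 2).
  apply: (@mulfI _ (2 : int)) => //.
  transitivity (S0 ^+ 2 + S1 ^+ 2 + S2 ^+ 2 - 6 * k ^+ 2).
    by rewrite S2E S0k; ring.
  by rewrite sum2; ring.
have [D S1E] := dvd3_sqr sq.
have pkD : p%:Z = k ^+ 2 + 3 * D ^+ 2.
  apply: (@mulfI _ (3 : int)) => //; transitivity ((S1 + k) ^+ 2 + 3 * k ^+ 2).
    by rewrite sq; ring.
  by rewrite S1E; ring.
have [Ak BD] := prime_form_unique p_pr pAB pkD.
have {Ak} kA : k = - A.
  move/eqP: Ak; rewrite eqf_sqr; move: S0k S0l Aj; clear.
  by move=> ? ? ? /orP[] /eqP ?; lia.
move/eqP: BD; rewrite eqf_sqr; move: S0k S1E S2E kA; clear.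
by move=> ? ? ? ? /orP[] /eqP ?; lia.
Qed.

(** * Reduction modulo p *)

Section Reduction.
Variable p : nat.
Hypothesis p_prime : prime p.

Lemma intr_Fp_eq0 (z : int) : (z%:~R == 0 :> 'F_p) = (p %| `|z|)%N.
Proof.
rewrite (dvdn_pcharf (pchar_Fp p_prime)) pmulrn abszE.
by have [z0|z0] := ger0P z; rewrite ?rmorphN ?oppr_eq0.
Qed.

(** [ratr] into ['F_p] is not a ring morphism on all of [rat], so membership in [Rp p] and the image
    are carried together through the field operations. *)
Definition reduces (r : rat) (x : 'F_p) := r \in Rp p /\ ratr r = x.

Lemma congpE u v x y : reduces u x -> reduces v y -> congp p u v = (x == y).
Proof. by rewrite /congp => -[-> ->] [-> ->]. Qed.

Lemma reduces_ratr r : r \in Rp p -> reduces r (ratr r).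
Proof. by []. Qed.

(** The fraction need not be in lowest terms: numq r * d = n * denq r and coprimality make [denq r]
    divide d, so it is nonzero modulo p. *)
Lemma reduces_frac (n d : int) : d%:~R != 0 :> 'F_p ->
  reduces (n%:~R / d%:~R) (n%:~R / d%:~R).
Proof.
move=> d0; set r : rat := n%:~R / d%:~R.
have dZ : d != 0 by apply: contraNneq d0 => ->.
have cross : numq r * d = n * denq r.
  apply: (@intr_inj rat); rewrite !rmorphM /= numqE /r.
  by field; rewrite intr_eq0.
have : (denq r %| d)%Z.
  rewrite -(@Gauss_dvdzr _ (numq r)) ?cross ?dvdz_mull //.
  by rewrite /coprimez /gcdz gcdnC; have := coprime_num_den r; rewrite /coprime => /eqP ->.
case/dvdzP=> k dE; have den0 : (denq r)%:~R != 0 :> 'F_p.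
  by apply: contraNneq d0 => e; rewrite dE rmorphM /= e mulr0.
split; first by rewrite inE -intr_Fp_eq0.
rewrite /ratr; apply/eqP; rewrite eqr_div // -!rmorphM /= cross.
by [].
Qed.

Lemma reducesP r x : reduces r x ->
  exists n d : int, [/\ d%:~R != 0 :> 'F_p, r = n%:~R / d%:~R & x = n%:~R / d%:~R].
Proof.
case=> rRp <-; exists (numq r), (denq r); split; rewrite ?divq_num_den //.
by rewrite intr_Fp_eq0.
Qed.

Lemma reduces_int (n : int) : reduces n%:~R n%:~R.
Proof.
have := @reduces_frac n 1; rewrite !rmorph1 !divr1; apply; exact: oner_neq0.
Qed.

Lemma intr_rat_neq0 (d : int) : d%:~R != 0 :> 'F_p -> d%:~R != 0 :> rat.
Proof. by rewrite intr_eq0; apply: contraNneq => ->. Qed.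

Lemma reducesD r s x y : reduces r x -> reduces s y -> reduces (r + s) (x + y).
Proof.
move=> /reducesP[n [d [d0 -> ->]]] /reducesP[k [e [e0 -> ->]]].
rewrite !addf_div ?intr_rat_neq0 // -!rmorphM -!rmorphD /=.
by apply: reduces_frac; rewrite rmorphM mulf_neq0.
Qed.

Lemma reducesM r s x y : reduces r x -> reduces s y -> reduces (r * s) (x * y).
Proof.
move=> /reducesP[n [d [d0 -> ->]]] /reducesP[k [e [e0 -> ->]]].
rewrite !mulf_div -!rmorphM /=.
by apply: reduces_frac; rewrite rmorphM mulf_neq0.
Qed.

Lemma reducesV r x : x != 0 -> reduces r x -> reduces r^-1 x^-1.
Proof.
move=> x0 /reducesP[n [d [d0 rE xE]]]; rewrite rE xE !invf_div.
apply: reduces_frac; apply: contraNneq x0 => n0; by rewrite xE n0 mul0r.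
Qed.

Lemma reducesX r x k : reduces r x -> reduces (r ^+ k) (x ^+ k).
Proof.
move=> rx; elim: k => [|k IH]; first exact: (reduces_int 1).
by rewrite !exprS; apply: reducesM.
Qed.

Lemma reduces_nat (k : nat) : reduces k%:R k%:R.
Proof. exact: (reduces_int k). Qed.

(** The bijection [phi] from ['I_p] to ['F_p] matches positive residues with nonzero elements and
    turns [congp] into equality. *)
Lemma V_values (a : rat) : a \in Rp p ->
  V p (fun x => x ^+ 2 + a / x)
  = #|[set x ^+ 2 + ratr a / x | x in [set x : 'F_p | x != 0]]|.
Proof.
move=> aRp; rewrite /V.
pose phi (i : 'I_p) : 'F_p := (i : nat)%:R.
have phi_inj : injective phi.
  move=> i j /(congr1 val); rewrite /= !val_Fp_nat // !modn_small //.
  exact: val_inj.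
have phi_surj (x : 'F_p) : exists2 i : 'I_p, x = phi i & (0 < i)%N = (x != 0).
  have ltp : (x < p)%N by have := ltn_ord x; rewrite [X in (_ < X)%N -> _]Fp_cast.
  exists (Ordinal ltp); first by apply: val_inj; rewrite /= val_Fp_nat // modn_small.
  by rewrite lt0n -[x == 0](inj_eq val_inj).
have phi0 (i : 'I_p) : (0 < i)%N = (phi i != 0).
  by have [j /phi_inj -> <-] := phi_surj (phi i).
rewrite -(card_imset _ phi_inj); apply: eq_card => y.
have red (i b : 'I_p) : (0 < i)%N ->
    congp p (i%:R ^+ 2 + a / i%:R) b%:R = (phi i ^+ 2 + ratr a / phi i == phi b).
  move=> i0; apply: congpE; last exact: reduces_nat.
  apply: reducesD; first exact/reducesX/reduces_nat.
  apply: reducesM; first exact: reduces_ratr.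
  by apply: reducesV; [rewrite -phi0 | apply: reduces_nat].
apply/imsetP/imsetP => [[b]|[x]].
  rewrite inE => /existsP[i /andP[i0]]; rewrite red // => /eqP ib ->.
  by exists (phi i); rewrite ?inE -?phi0 ?ib.
rewrite inE => x0 ->; have [i xi i0] := phi_surj x.
have [b bE _] := phi_surj (x ^+ 2 + ratr a / x).
exists b => //; rewrite inE; apply/existsP; exists i.
by rewrite i0 x0 red ?i0 // -xi bE eqxx.
Qed.
End Reduction.

Lemma prime_form_Fp (p : nat) (A B : int) : prime p ->
  p%:Z = A ^+ 2 + 3 * B ^+ 2 -> A%:~R ^+ 2 + 3 * B%:~R ^+ 2 = 0 :> 'F_p.
Proof.
move=> p_pr pAB; have := congr1 (fun z : int => z%:~R : 'F_p) pAB.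
by rewrite /= rmorphD rmorphM !rmorphXn /= -pmulrn (pcharf0 (pchar_Fp p_pr)) => <-.
Qed.

(** If p divides B, it divides A as well, and then p^2 divides p. *)
Lemma prime_form_coprime (p : nat) (A B : int) : prime p ->
  p%:Z = A ^+ 2 + 3 * B ^+ 2 -> B%:~R != 0 :> 'F_p.
Proof.
move=> p_pr pAB; have pAB0 := prime_form_Fp p_pr pAB.
apply/eqP => B0; have A0 : A%:~R = 0 :> 'F_p.
  by move/eqP: pAB0; rewrite B0 expr0n mulr0 addr0 expf_eq0 => /eqP.
move/eqP: A0; rewrite intr_Fp_eq0 // -[p in (p %| _)%N]absz_nat -dvdzE => /dvdzP[k Ak].
move/eqP: B0; rewrite intr_Fp_eq0 // -[p in (p %| _)%N]absz_nat -dvdzE => /dvdzP[l Bl].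
have p0 : p%:Z != 0 by rewrite eqz_nat -lt0n prime_gt0.
have : (p %| 1%Z)%Z.
  apply/dvdzP; exists (k ^+ 2 + 3 * l ^+ 2); apply: (mulfI p0).
  by rewrite mulr1 {1}pAB Ak Bl; ring.
by rewrite dvdzE dvdn1 /= => /eqP p1; rewrite p1 in p_pr.
Qed.

Lemma Fp_nat_neq0 (p k : nat) : prime p -> (0 < k < p)%N -> k%:R != 0 :> 'F_p.
Proof.
move=> p_pr /andP[k0 kp]; rewrite -(dvdn_pcharf (pchar_Fp p_pr)).
by apply/negP => /(dvdn_leq k0); rewrite leqNgt kp.
Qed.

(** Since (x / y)^2 = -3, the first factor is a root of w^2 + w + 1. The identity links the
    candidate values -2 A and A - 3 e B of the cubic sum in ['F_p]. *)
Lemma halfN1_mul (K : fieldType) (x y e : K) : (2 : K) != 0 -> y != 0 ->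
  e ^+ 2 = 1 -> x ^+ 2 + 3 * y ^+ 2 = 0 ->
  (-1 + e * (x / y)) / 2 * (x - 3 * e * y) = - 2 * x.
Proof.
move=> two0 y0 e2 xy.
transitivity ((- x + e * (x ^+ 2 + 3 * y ^+ 2) / y - 3 * e ^+ 2 * x) / 2).
  by field; rewrite two0 y0.
by rewrite e2 xy; field; rewrite two0 y0.
Qed.

(** * Cubic sums over ['F_p] for p = 1 modulo 3 *)

Section PrimeOneModThree.
Variables (p m n : nat) (A B : int).
Hypotheses (p_prime : prime p) (p_gt3 : (3 < p)%N).
Hypotheses (pm : p = m.*2.+1) (pn : p = (3 * n).+1).
Hypothesis pAB : p%:Z = A ^+ 2 + 3 * B ^+ 2.
Hypothesis A_mod3 : (A = 1 %[mod 3])%Z.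

Let cardF : #|'F_p| = m.*2.+1. Proof. by rewrite card_Fp. Qed.
Let cardF3 : #|'F_p| = (3 * n).+1. Proof. by rewrite card_Fp. Qed.

(** Only the exponent modulo 3 of d as a power of g matters. Which of A + 3 B and A - 3 B belongs to
    the class of g depends on the choice of g and stays open. *)
Lemma cubic_sum_Fp_range (d : 'F_p) : d != 0 ->
  cubic_sum m (1 : 'F_p) = - 2 * A /\
  [\/ cubic_sum m d = - 2 * A, cubic_sum m d = A + 3 * B | cubic_sum m d = A - 3 * B].
Proof.
move=> d0; have [g gP] := finField_prim_root 'F_p.
have [k S0k] := cubic_sum1_even cardF cardF3.
have [l S0l] := cubic_sum_mod3 m cardF3 1.
have Aj : A = 1 + 3 * (A %/ 3)%Z by rewrite {1}(divz_eq A 3) A_mod3; ring.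
have sum2 := sum_cubic_sum_sqr_classes cardF cardF3 gP.
rewrite card_Fp // [p%:R]natz in sum2.
have [S0 S12] := cubic_sum_classes_eq p_prime pAB Aj S0k S0l
  (sum_cubic_sum_classes cardF cardF3 gP) sum2.
split=> //; have [i ->] := prim_root_log gP d0.
have red j : cubic_sum m (g ^+ (j + i %/ 3 * 3)) = cubic_sum m (g ^+ j).
  elim: (_ %/ 3)%N => [|t IH]; first by rewrite addn0.
  by rewrite mulSn addnCA addnC (cubic_sum_prim_root_period _ _ gP).
rewrite (divn_eq i 3) addnC red; have := ltn_pmod i (isT : (0 < 3)%N).
case: (i %% 3)%N => [|[|[|//]]] _; rewrite ?expr0 ?expr1.
- by constructor 1.
- by case: S12 => [[-> _]|[-> _]]; [constructor 2 | constructor 3].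
- by case: S12 => [[_ ->]|[_ ->]]; [constructor 3 | constructor 2].
Qed.

Let B0 : B%:~R != 0 :> 'F_p := prime_form_coprime p_prime pAB.
Let two0 : (2 : 'F_p) != 0.
Proof. by apply: Fp_nat_neq0 => //; rewrite (ltn_trans _ p_gt3). Qed.
Let three0 : (3 : 'F_p) != 0.
Proof. exact: Fp_nat_neq0. Qed.

Let form0 : A%:~R ^+ 2 + 3 * B%:~R ^+ 2 = 0 :> 'F_p := prime_form_Fp p_prime pAB.

(** Otherwise A^2 = B^2 and 4 B^2 = 0 in ['F_p]. This separates -2 A from A + 3 B and A - 3 B modulo
    p, the differences being 3 (A + B) and 3 (A - B) up to sign. *)
Let AB_neq (e : 'F_p) : e ^+ 2 = 1 -> A%:~R != e * B%:~R.
Proof.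
move=> e2; apply/eqP => AeB; have /eqP : 2 * 2 * B%:~R ^+ 2 = 0 :> 'F_p.
  by rewrite -form0 AeB exprMn e2; ring.
by rewrite !mulf_eq0 (negPf two0) (negPf B0).
Qed.

Let cubic_sum_res (d : 'F_p) : d != 0 ->
  (cubic_sum m d)%:~R = d ^+ n * (- 2 * A%:~R) :> 'F_p.
Proof.
move=> d0; rewrite (cubic_sum_expr cardF cardF3 d0).
by have [-> _] := cubic_sum_Fp_range d0; rewrite !(rmorphN, rmorphM, rmorph_nat).
Qed.

Lemma cubic_sum_Fp_cube (d : 'F_p) : d != 0 -> d ^+ n = 1 ->
  cubic_sum m d = - 2 * A.
Proof.
move=> d0 dn; have := cubic_sum_res d0; rewrite dn mul1r.
have [_ []->//] := cubic_sum_Fp_range d0;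
  rewrite !(rmorphD, rmorphN, rmorphM, rmorph_nat) /= => /eqP; rewrite -subr_eq0.
- rewrite (_ : _ - _ = 3 * (A%:~R - (-1) * B%:~R)); last by ring.
  by rewrite mulf_eq0 (negPf three0) subr_eq0 (negPf (AB_neq _)) // sqrrN expr1n.
- rewrite (_ : _ - _ = 3 * (A%:~R - 1 * B%:~R)); last by ring.
  by rewrite mulf_eq0 (negPf three0) subr_eq0 (negPf (AB_neq _)) // expr1n.
Qed.

(** By [halfN1_mul] the sum is A - 3 e B in ['F_p]; the three candidates are distinct modulo p, so
    this residue fixes the integer. *)
Lemma cubic_sum_Fp_noncube (d : 'F_p) (e : int) : e = 1 \/ e = -1 -> d != 0 ->
  d ^+ n * ((-1 + e%:~R * (A%:~R / B%:~R)) / 2) = 1 ->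
  cubic_sum m d = A - 3 * e * B.
Proof.
move=> e1 d0 dn; have e2 : e%:~R ^+ 2 = 1 :> 'F_p by case: e1 => ->; rewrite ?sqrrN expr1n.
have SE : (cubic_sum m d)%:~R = A%:~R - 3 * e%:~R * B%:~R :> 'F_p.
  rewrite cubic_sum_res //; apply: etrans (etrans (congr1 ( *%R^~ _) dn) (mul1r _)).
  rewrite -[RHS]mulrA; congr (_ * _); by rewrite halfN1_mul.
have [_ [] SdE] := cubic_sum_Fp_range d0; move: SE;
  rewrite SdE !(rmorphD, rmorphN, rmorphM, rmorph_nat) /= => /eqP; rewrite -subr_eq0.
- rewrite (_ : _ - _ = - 3 * (A%:~R - e%:~R * B%:~R)); last by ring.
  by rewrite mulf_eq0 oppr_eq0 (negPf three0) subr_eq0 (negPf (AB_neq e2)).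
- case: e1 => ->; last by move=> _; ring.
  rewrite (_ : _ - _ = 2 * (3 * B%:~R)); last by ring.
  by rewrite !mulf_eq0 (negPf two0) (negPf three0) (negPf B0).
- case: e1 => ->; first by move=> _; ring.
  rewrite (_ : _ - _ = - 2 * (3 * B%:~R)); last by ring.
  by rewrite !mulf_eq0 oppr_eq0 (negPf two0) (negPf three0) (negPf B0).
Qed.
End PrimeOneModThree.

Theorem theorem2p1 (p : nat) (a : rat) (p_prime : prime p) (p_gt3 : (3 < p)%N)
    (aRp : a \in Rp p) (a_neq0 : ~~ congp p a 0) :
  ((p = 2 %[mod 3])%N ->
     (V p (fun x => x ^+ 2 + a / x))%:R = (2 * p%:R - 1) / 3 :> rat) /\
  ((p = 1 %[mod 3])%N ->
     forall A B : int,
       p%:Z = A ^+ 2 + 3 * B ^+ 2 -> (A = 1 %[mod 3])%Z ->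
       (congp p ((2 * a ^+ 2) ^+ ((p - 1) %/ 3)%N) 1 ->
          (V p (fun x => x ^+ 2 + a / x))%:R
            = (2 * p%:R - 1 + 2 * A%:~R) / 3 :> rat) /\
       (forall eps : int, eps = 1 \/ eps = -1 ->
          congp p ((2 * a ^+ 2) ^+ ((p - 1) %/ 3)%N)
                  ((-1 + eps%:~R * (A%:~R / B%:~R)) / 2) ->
          (V p (fun x => x ^+ 2 + a / x))%:R
            = (2 * p%:R - 1 - A%:~R + 3 * eps%:~R * B%:~R) / 3 :> rat)).
Proof.
have := reduces_ratr aRp; have := V_values p_prime aRp.
move: (ratr a) => b VA redA.
have b0 : b != 0 by rewrite -(congpE redA (reduces_int p_prime 0)).
have [two0 three0] : (2 : 'F_p) != 0 /\ (3 : 'F_p) != 0.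
  by split; apply: Fp_nat_neq0; rewrite // (ltn_trans _ p_gt3).
have b40 : 4 * b != 0.
  by rewrite (_ : 4 * b = 2 * (2 * b)) ?mulf_neq0 //; ring.
have pm : p = p./2.*2.+1.
  by have := odd_double_half p; case: (even_prime p_prime) p_gt3 => [->//|-> _ /esym].
have cardF : #|'F_p| = p./2.*2.+1 by rewrite card_Fp.
have VE (S : int) : cubic_sum p./2 (4 * b) = S ->
    (V p (fun x => x ^+ 2 + a / x))%:R = (2 * p%:R - 1 - S%:~R) / 3 :> rat.
  move=> <-; rewrite VA.
  have := congr1 (fun z : int => z%:~R : rat) (card_values cardF three0 b0).
  rewrite card_Fp // !(rmorphD, rmorphN, rmorphM, rmorph_nat, rmorph1) /= -!pmulrn => <-.
  by field.
split=> [p2|p1 A B pAB A1].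
  have pk : p = (3 * (p %/ 3)).+2 by rewrite {1}(divn_eq p 3) p2 mulnC addn2.
  by rewrite (VE 0) ?subr0 // (cubic_sum_eq0 cardF (k := p %/ 3)) // card_Fp.
set n := ((p - 1) %/ 3)%N.
have pn : p = (3 * n).+1.
  rewrite /n mulnC divnK ?subn1 ?prednK ?prime_gt0 // -subn1.
  by rewrite -eqn_mod_dvd ?prime_gt0 // p1.
have redn : reduces ((2 * a ^+ 2) ^+ n) ((2 * b ^+ 2) ^+ n).
  apply: reducesX => //; apply: reducesM => //; first exact: (reduces_int p_prime 2).
  exact: reducesX.
(* As 4 b * 2 b^2 = (2 b)^3, the two n-th powers are inverse to each other: the hypothesis on 2 a^2
   becomes one on the argument 4 a of the cubic sum. *)
have bn : (4 * b) ^+ n * (2 * b ^+ 2) ^+ n = 1.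
  rewrite -exprMn (_ : 4 * b * _ = (2 * b) ^+ 3); last by ring.
  rewrite -exprM (_ : (3 * n)%N = #|'F_p|.-1); last by rewrite card_Fp // [in RHS]pn.
  by rewrite expf_card_pred // mulf_neq0.
split=> [|e e1].
  rewrite (congpE redn (reduces_int p_prime 1)) => /eqP b1.
  rewrite b1 mulr1 in bn.
  rewrite (VE _ (cubic_sum_Fp_cube p_prime p_gt3 pm pn pAB A1 b40 bn)).
  by rewrite rmorphM /=; ring.
have B0 := prime_form_coprime p_prime pAB.
have red_e : reduces ((-1 + e%:~R * (A%:~R / B%:~R)) / 2)
    ((-1 + e%:~R * (A%:~R / B%:~R)) / 2 : 'F_p).
  apply: reducesM => //; last exact/reducesV/(reduces_int p_prime 2).
  apply: reducesD => //; first exact: (reduces_int p_prime (-1)).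
  by apply: reducesM => //; [exact: reduces_int | exact: reduces_frac].
rewrite (congpE redn red_e) => /eqP be; rewrite be in bn.
rewrite (VE _ (cubic_sum_Fp_noncube p_prime p_gt3 pm pn pAB A1 e1 b40 bn)).
by rewrite !(rmorphD, rmorphN, rmorphM, rmorph_nat, rmorph1) /=; ring.
Qed.
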